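(* Let $\mathbb{I}=(I,\le,\mathcal{I})$ be a set of indices, let $\mathcal{J}\subseteq\mathcal{I}$ be a nonempty subset such that for all $A,B\in\mathcal{J}$ there is $C\in\mathcal{J}$ with $C\subseteq A\cap B$, and let $(x_\varepsilon),(y_\varepsilon),(z_\varepsilon)\in\mathbb{R}^I$ be nets of real numbers. Then, as $\varepsilon\in\mathbb{I}$: (i) $x_\varepsilon=O_{\mathcal{J}}(x_\varepsilon)$; (ii) if $x_\varepsilon=O_{\mathcal{J}}(y_\varepsilon)$ and $y_\varepsilon=O_{\mathcal{J}}(z_\varepsilon)$, then $x_\varepsilon=O_{\mathcal{J}}(z_\varepsilon)$; (iii) $O_{\mathcal{J}}(x_\varepsilon)\cdot O_{\mathcal{J}}(y_\varepsilon)=O_{\mathcal{J}}(x_\varepsilon\cdot y_\varepsilon)$; (iv) $O_{\mathcal{J}}(x_\varepsilon)+O_{\mathcal{J}}(y_\varepsilon)=O_{\mathcal{J}}(|x_\varepsilon|+|y_\varepsilon|)$; (v) $x_\varepsilon\cdot O_{\mathcal{J}}(y_\varepsilon)=O_{\mathcal{J}}(x_\varepsilon\cdot y_\varepsilon)$; (vi) $O_{\mathcal{J}}(x_\varepsilon)+O_{\mathcal{J}}(x_\varepsilon)=O_{\mathcal{J}}(x_\varepsilon)$; (vii) if $x_\varepsilon,y_\varepsilon\ge 0$ for all $\varepsilon\in I$, then $x_\varepsilon+O_{\mathcal{J}}(y_\varepsilon)=O_{\mathcal{J}}(x_\varepsilon+y_\varepsilon)$; (viii) for all $k\in\mathbb{R}$: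 $O_{\mathcal{J}}(k\cdot x_\varepsilon)=O_{\mathcal{J}}(x_\varepsilon)$; (ix) for all $k\in\mathbb{R}$: $k\cdot O_{\mathcal{J}}(x_\varepsilon)=O_{\mathcal{J}}(x_\varepsilon)$.
   Context: A set of indices is a triple $\mathbb{I}=(I,\le,\mathcal{I})$ such that: (1) $I$ is a nonempty set and $\le$ is a reflexive and transitive relation on $I$; (2) $\mathcal{I}$ is a set of subsets of $I$ with $\emptyset\notin\mathcal{I}$ and $I\in\mathcal{I}$; (3) for all $A,B\in\mathcal{I}$ there is $C\in\mathcal{I}$ with $C\subseteq A\cap B$; (4) writing $(\emptyset,e]:=\{\varepsilon\in I\mid\varepsilon\le e\}$, $A_{\le e}:=(\emptyset,e]\cap A$, and $\varepsilon<e$ for ''$\varepsilon\le e$ and $\varepsilon\neq e$'': whenever $e\le a\in A\in\mathcal{I}$, the set $A_{\le e}$ is nonempty and for all $b,c\in A_{\le e}$ there is $d\in A_{\le e}$ with $d<b$ and $d<c$. (It is not required that $e\in A$.) For $a\in A\in\mathcal{I}$, one writes $x_\varepsilon=O_{a,A}(y_\varepsilon)$ if there exist $H\in\mathbb{R}_{>0}$ and $\varepsilon_0\in A_{\le a}$ such that $|x_\varepsilon|\le H\cdot|y_\varepsilon|$ for all $\varepsilon\in A_{\le\varepsilon_0}$. One writes $x_\varepsilon=O_{\mathcal{J}}(y_\varepsilon)$ as $\varepsilon\in\mathbb{I}$ if there exists $A\in\mathcal{J}$ such that for all $a\in A$: $x_\varepsilon=O_{a,A}(y_\varepsilon)$.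 Equalities between big-O expressions are read from left to right: e.g. (iii) means that if $x'_\varepsilon=O_{\mathcal{J}}(x_\varepsilon)$ and $y'_\varepsilon=O_{\mathcal{J}}(y_\varepsilon)$ then $x'_\varepsilon y'_\varepsilon=O_{\mathcal{J}}(x_\varepsilon y_\varepsilon)$; (viii) means that $x'_\varepsilon=O_{\mathcal{J}}(kx_\varepsilon)$ implies $x'_\varepsilon=O_{\mathcal{J}}(x_\varepsilon)$; and similarly for the others. *)

(* Defs.v *)
From HB Require Import structures.
From mathcomp Require Import all_boot all_order all_algebra.
From mathcomp Require Import boolp classical_sets reals.
Set Implicit Arguments.
Unset Strict Implicit.
Unset Printing Implicit Defensive.
Import Order.TTheory GRing.Theory Num.Theory.
Local Open Scope classical_set_scope.
Local Open Scope ring_scope.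

Section DownSets.
Variables (I : Type) (le : I -> I -> Prop).

(* [le] is only a preorder: strictness means "below and distinct", so two
   distinct equivalent points are strictly below each other. *)
Definition idx_strict (e f : I) : Prop := le e f /\ e <> f.

Definition downset (e : I) : set I := [set eps | le eps e].

(* A_{<= e}; the point e need not belong to A. *)
Definition below (A : set I) (e : I) : set I := downset e `&` A.
End DownSets.

Record setOfIndices := SetOfIndices {
  idx :> Type;
  idx_le : idx -> idx -> Prop;
  idx_fam : set (set idx);
  idx_nonempty : [set: idx] !=set0;
  idx_le_refl : forall e, idx_le e e;
  idx_le_trans : forall e f g, idx_le e f -> idx_le f g -> idx_le e g;
  idx_fam_set0 : ~ idx_fam set0;
  idx_fam_setT : idx_fam [set: idx];
  idx_fam_capP : forall A B, idx_fam A -> idx_fam B ->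
    exists2 C, idx_fam C & C `<=` A `&` B;
  idx_belowP : forall A a e, idx_fam A -> A a -> idx_le e a ->
    below idx_le A e !=set0 /\
    forall b c, below idx_le A e b -> below idx_le A e c ->
      exists d, [/\ below idx_le A e d, idx_strict idx_le d b
                  & idx_strict idx_le d c]
}.

Section BigO.
Variables (R : realType) (I : setOfIndices).
Implicit Types (A : set I) (J : set (set I)) (x y : I -> R).

(* Only meaningful when a belongs to A and A to the family of I. *)
Definition bigO_at (a : I) A x y : Prop :=
  exists H : R, 0 < H /\
  exists eps0 : I, below (@idx_le I) A a eps0 /\
  forall eps, below (@idx_le I) A eps0 eps -> `|x eps| <= H * `|y eps|.

Definition bigO J x y : Prop :=
  exists A, J A /\ forall a, A a -> bigO_at a A x y.
End BigO.

(* Main.v *)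
Require Import Defs.
From HB Require Import structures.
From mathcomp Require Import all_boot all_order all_algebra.
From mathcomp Require Import boolp classical_sets reals.
Set Implicit Arguments.
Unset Strict Implicit.
Unset Printing Implicit Defensive.
Import Order.TTheory GRing.Theory Num.Theory.
Local Open Scope classical_set_scope.
Local Open Scope ring_scope.

(** All nine rules are pointwise inequalities between absolute values once the
    estimates involved hold on a common set: with [`|x'| <= H1 * `|x|] and
    [`|y'| <= H2 * `|y|] at the same point, the desired bound there is the
    triangle inequality or the multiplicativity of the norm.  So the content
    lies in bringing two estimates [x' = O_J x] and [y' = O_J y] to a common
    set, which is [bigO_combine].

    Two estimates come with different sets [A], [B] of [J]; directedness of [J]
    gives [C] in [J] inside both, and [bigO_at_sub] restricts each estimate to
    [C].  This restriction is where the axioms of a set of indices enter: the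
    threshold found in [A] need not lie in [C], but, lying below a point of
    [C], it has points of [C] below it.  Two thresholds in [C] below the same
    point then have a common lower bound in [C], under which both estimates
    hold. *)

(** The threshold [e0] of the given estimate belongs to [A] only.  Since
    [e0 <= a] and [a] is in [C], the set of points of [C] below [e0] is
    nonempty, and any of them is a threshold in [C]. *)
Lemma bigO_at_sub (R : realType) (I : setOfIndices) (A C : set I) (a : I)
    (x y : I -> R) :
  idx_fam C -> C `<=` A -> C a -> bigO_at a A x y -> bigO_at a C x y.
Proof.
move=> famC sCA Ca [H [H0 [e0 [[le_e0a _] xy]]]].
have [[d [le_de0 Cd]] _] := idx_belowP famC Ca le_e0a.
exists H; split=> //; exists d; split.
  by split=> //; apply: idx_le_trans le_de0 le_e0a.
move=> e [le_ed Ce]; apply: xy; split; last exact: sCA.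
exact: idx_le_trans le_ed le_de0.
Qed.

(** Reduces a rule for [O_J] to an inequality at a single point.  The constant
    [H] is uniform in the point, so it may depend only on [H1] and [H2], hence
    the order of the quantifiers in the hypothesis.  A rule with a single
    estimate as premise is obtained by using that estimate twice. *)
Lemma bigO_combine (R : realType) (I : setOfIndices) (J : set (set I))
    (x x' y y' u w : I -> R) :
  J `<=` @idx_fam I ->
  (forall A B : set I, J A -> J B -> exists2 C : set I, J C & C `<=` A `&` B) ->
  (forall H1 H2 : R, 0 < H1 -> 0 < H2 -> exists2 H : R, 0 < H &
     forall e, `|x' e| <= H1 * `|x e| -> `|y' e| <= H2 * `|y e| ->
       `|u e| <= H * `|w e|) ->
  bigO J x' x -> bigO J y' y -> bigO J u w.
Proof.
move=> J_sub J_dir comb [A [JA xA]] [B [JB yB]].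
have [C JC sC] := J_dir _ _ JA JB; have famC := J_sub _ JC.
exists C; split=> // a Ca; have [Aa Ba] := sC _ Ca.
have sCA : C `<=` A by move=> e /sC[].
have sCB : C `<=` B by move=> e /sC[].
have [H1 [H1_gt0 [e1 [e1a xC]]]] := bigO_at_sub famC sCA Ca (xA _ Aa).
have [H2 [H2_gt0 [e2 [e2a yC]]]] := bigO_at_sub famC sCB Ca (yB _ Ba).
have [_ dirC] := idx_belowP famC Ca (idx_le_refl a).
have [d [da [le_de1 _] [le_de2 _]]] := dirC _ _ e1a e2a.
have [H H_gt0 uw] := comb _ _ H1_gt0 H2_gt0.
exists H; split=> //; exists d; split=> // e [le_ed Ce].
apply: uw; [apply: xC | apply: yC]; split=> //.
- exact: idx_le_trans le_ed le_de1.
- exact: idx_le_trans le_ed le_de2.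
Qed.

Lemma bigO_refl (R : realType) (I : setOfIndices) (J : set (set I))
    (x : I -> R) :
  J !=set0 -> bigO J x x.
Proof.
move=> [A JA]; exists A; split=> // a Aa; exists 1; split; first exact: ltr01.
exists a; split; first by split=> //; apply: idx_le_refl.
by move=> e _; rewrite mul1r.
Qed.

Theorem theorem16 (R : realType) (I : setOfIndices) (J : set (set I))
    (J_sub : J `<=` @idx_fam I) (J_nonempty : J !=set0)
    (J_dir : forall A B : set I, J A -> J B ->
       exists2 C : set I, J C & C `<=` A `&` B)
    (x y z : I -> R) :
  (* (i) *)
  bigO J x x
  (* (ii) *)
  /\ (bigO J x y -> bigO J y z -> bigO J x z)
  (* (iii) *)
  /\ (forall x' y' : I -> R, bigO J x' x -> bigO J y' y ->
        bigO J (fun e => x' e * y' e) (fun e => x e * y e))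
  (* (iv) *)
  /\ (forall x' y' : I -> R, bigO J x' x -> bigO J y' y ->
        bigO J (fun e => x' e + y' e) (fun e => `|x e| + `|y e|))
  (* (v) *)
  /\ (forall y' : I -> R, bigO J y' y ->
        bigO J (fun e => x e * y' e) (fun e => x e * y e))
  (* (vi) *)
  /\ (forall x' x'' : I -> R, bigO J x' x -> bigO J x'' x ->
        bigO J (fun e => x' e + x'' e) x)
  (* (vii) *)
  /\ ((forall e : I, 0 <= x e /\ 0 <= y e) ->
      forall y' : I -> R, bigO J y' y ->
        bigO J (fun e => x e + y' e) (fun e => x e + y e))
  (* (viii) *)
  /\ (forall (k : R) (x' : I -> R), bigO J x' (fun e => k * x e) -> bigO J x' x)
  (* (ix) *)
  /\ (forall (k : R) (x' : I -> R), bigO J x' x ->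
        bigO J (fun e => k * x' e) x).
Proof.
have combine := bigO_combine J_sub J_dir.
have refl (u : I -> R) : bigO J u u by exact: bigO_refl.
have mul (x0 y0 x' y' : I -> R) : bigO J x' x0 -> bigO J y' y0 ->
    bigO J (fun e => x' e * y' e) (fun e => x0 e * y0 e).
  apply: combine => H1 H2 H1_gt0 H2_gt0.
  exists (H1 * H2); first exact: mulr_gt0.
  by move=> e xe ye; rewrite !normrM mulrACA ler_pM.
have add x' y' : bigO J x' x -> bigO J y' y ->
    bigO J (fun e => x' e + y' e) (fun e => `|x e| + `|y e|).
  apply: combine => H1 H2 H1_gt0 H2_gt0.
  exists (H1 + H2); first exact: addr_gt0.
  move=> e xe ye; rewrite [X in _ * X]ger0_norm ?addr_ge0 //.
  apply: le_trans (ler_normD _ _) _; rewrite mulrDr.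
  apply: lerD; [apply: le_trans xe _ | apply: le_trans ye _].
  - by rewrite ler_wpM2r // lerDl ltW.
  - by rewrite ler_wpM2r // lerDr ltW.
split; first exact: refl.
split.
  apply: combine => H1 H2 H1_gt0 H2_gt0.
  exists (H1 * H2); first exact: mulr_gt0.
  by move=> e xe ye; apply: le_trans xe _; rewrite -mulrA ler_pM2l.
split; first exact: mul.
split; first exact: add.
split; first by move=> y' yO; apply: mul.
split.
  move=> x' x''; apply: combine => H1 H2 H1_gt0 H2_gt0.
  exists (H1 + H2); first exact: addr_gt0.
  move=> e xe ye; apply: le_trans (ler_normD _ _) _.
  by rewrite mulrDl lerD.
split.
  move=> xy_ge0 y' yO.
  have -> : (fun e => x e + y e) = (fun e => `|x e| + `|y e|).
    by apply/funext => e; have [x0 y0] := xy_ge0 e; rewrite !ger0_norm.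
  exact: add.
(* In both remaining rules [k] may vanish: the factor [`|k| + 1] in place of
   [`|k|] keeps the constant positive. *)
split=> k x' xO; apply: combine (xO) (xO) => H1 H2 H1_gt0 _;
  (exists (H1 * (`|k| + 1)); first by rewrite mulr_gt0 // ltr_wpDl);
  move=> e xe _.
- apply: le_trans xe _; rewrite normrM -mulrA ler_pM2l // ler_wpM2r //.
  by rewrite lerDl.
- by rewrite normrM [H1 * _]mulrC -mulrA ler_pM // lerDl.
Qed.
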